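(* If $G$ is a marked graph then $[G]=[G_{cru}^{v}]$ for every $v\in V(G)$.
   Context: A marked graph is a finite undirected graph $G$ without multiple edges, in which each vertex may be looped or unlooped, each vertex is either unmarked or carries one of the marks $r,c,cr,u,ur$, together with a number $\phi\ge 0$ of free loops (extra components with no vertices or edges). ''Adjacent'' and ''neighbor'' refer to distinct vertices. Marked local complement: for $v\in V(G)$, $G_{cru}^v$ is obtained from $G$ by making exactly these changes. (i) The mark of $v$ changes by unmarked $\leftrightarrow u$, $r\leftrightarrow ur$, $c\leftrightarrow cr$. (ii) The mark of each neighbor of $v$ changes by unmarked $\leftrightarrow r$, $c\leftrightarrow ur$, $u\leftrightarrow cr$. (iii) For any two distinct neighbors $x,y$ of $v$, the adjacency between $x$ and $y$ is toggled. Loops and free loops are not changed. Marked-graph bracket: let $V(G)=\{v_1,\dots,v_n\}$. The Boolean adjacency matrix $\mathcal{A}(G)$ is the $n\times n$ matrix over $GF(2)$ with $(i,j)$ entry ($i\neq j$) equal to $1$ iff $v_i,v_j$ are adjacent, and $(i,i)$ entry equal to $1$ iff $v_i$ is looped. For $T\subseteq V(G)$, $\Delta_T$ is the diagonal matrix over $GF(2)$ whose $i$-th diagonal entry is $1$ iff either $v_i\in T$ and the mark of $v_i$ does not involve the letter $r$, or $v_i\notin T$ and the mark of $v_i$ involves $r$ (being unmarked counts as not involving $r$). $\mathcal{A}(G)_T$ is the submatrix of $\mathcal{A}(G)+\Delta_T$ obtained by removing the $i$-th row and column whenever either $v_i$ is marked $c$ or $cr$ and $(\mathcal{A}(G)+\Delta_T)_{ii}=0$,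 or $v_i$ is marked $u$ or $ur$ and $(\mathcal{A}(G)+\Delta_T)_{ii}=1$. Then $$[G]=d^{\phi}\sum_{T\subseteq V(G)}A^{n-|T|}B^{|T|}d^{\nu(\mathcal{A}(G)_T)}\in\mathbb{Z}[A,B,d],$$ where $\nu$ denotes $GF(2)$-nullity (the empty matrix has nullity $0$). *)

(* Defs.v *)
From mathcomp Require Import all_boot all_order all_algebra.
From mathcomp Require Import mpoly.

Set Implicit Arguments.
Unset Strict Implicit.
Unset Printing Implicit Defensive.

Import GRing.Theory.
Local Open Scope ring_scope.

Inductive mark := Unmarked | Mr | Mc | Mcr | Mu | Mur.

Definition involves_r (m : mark) : bool :=
  match m with Mr | Mcr | Mur => true | _ => false end.

Definition c_or_cr (m : mark) : bool :=
  match m with Mc | Mcr => true | _ => false end.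

Definition u_or_ur (m : mark) : bool :=
  match m with Mu | Mur => true | _ => false end.

(* [edge x x] means that [x] is looped. *)
Record mgraph (V : finType) := MGraph {
  edge : rel V;
  edge_sym : ssrbool.symmetric edge;
  marking : V -> mark;
  free_loops : nat
}.

Definition looped (V : finType) (G : mgraph V) (x : V) : bool := edge G x x.

Definition adjacent (V : finType) (G : mgraph V) (x y : V) : bool :=
  (x != y) && edge G x y.

Definition mark_center (m : mark) : mark :=
  match m with
  | Unmarked => Mu | Mu => Unmarked
  | Mr => Mur | Mur => Mr
  | Mc => Mcr | Mcr => Mc
  end.

Definition mark_neighbor (m : mark) : mark :=
  match m with
  | Unmarked => Mr | Mr => Unmarked
  | Mc => Mur | Mur => Mc
  | Mu => Mcr | Mcr => Mu
  end.

Section MarkedLocalComplement.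
Variables (V : finType) (G : mgraph V) (v : V).

Definition lc_marking (x : V) : mark :=
  if x == v then mark_center (marking G x)
  else if adjacent G v x then mark_neighbor (marking G x)
  else marking G x.

Definition lc_edge : rel V := fun x y =>
  edge G x y (+) [&& x != y, adjacent G v x & adjacent G v y].

Lemma lc_edge_sym : ssrbool.symmetric lc_edge.
Proof.
by move=> x y; rewrite /lc_edge edge_sym eq_sym [adjacent G v x && _]andbC.
Qed.

Definition marked_lc : mgraph V :=
  MGraph lc_edge_sym lc_marking (free_loops G).

End MarkedLocalComplement.

Section Bracket.
Variables (V : finType) (G : mgraph V).

Definition adjm : 'M['F_2]_#|V| :=
  \matrix_(i, j)
    (if i == j then looped G (enum_val i)
     else adjacent G (enum_val i) (enum_val j))%:R.

Definition deltam (T : {set V}) : 'M['F_2]_#|V| :=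
  diag_mx (\row_i ((enum_val i \in T) (+) involves_r (marking G (enum_val i)))%:R).

Definition removed (T : {set V}) (i : 'I_#|V|) : bool :=
  (c_or_cr (marking G (enum_val i)) && ((adjm + deltam T) i i == 0))
  || (u_or_ur (marking G (enum_val i)) && ((adjm + deltam T) i i == 1)).

Definition kept (T : {set V}) : {set 'I_#|V|} := [set i | ~~ removed T i].

Definition adjm_T (T : {set V}) : 'M['F_2]_#|kept T| :=
  mxsub enum_val enum_val (adjm + deltam T).

End Bracket.

(* [kermx] is the left kernel; for a square matrix its dimension is that of the
   right kernel. *)
Definition nullity (n : nat) (M : 'M['F_2]_n) : nat := \rank (kermx M).

(* Z[A,B,d]: the indeterminates number 0, 1, 2 are A, B, d. *)
Definition varA : {mpoly int[3]} := 'X_(@Ordinal 3 0 isT).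
Definition varB : {mpoly int[3]} := 'X_(@Ordinal 3 1 isT).
Definition vard : {mpoly int[3]} := 'X_(@Ordinal 3 2 isT).

Definition bracket (V : finType) (G : mgraph V) : {mpoly int[3]} :=
  vard ^+ free_loops G *
  \sum_(T : {set V})
    varA ^+ (#|V| - #|T|) * varB ^+ #|T| * vard ^+ nullity (adjm_T G T).

(* Main.v *)
Require Import Defs.
From mathcomp Require Import all_boot all_order all_algebra.

(** The bracket is invariant term by term. For fixed [T], put each vertex in one
    of three states: removed, kept with diagonal entry 0, or kept with diagonal
    entry 1. Marked local complementation at [v] exchanges "removed" and "1" at
    [v], exchanges "0" and "1" at the neighbors of [v], and changes nothing
    elsewhere. Write [rho] for the adjacency row of [v] and [M] for the rest of
    the matrix.
    If [v] is in state 0, the matrix becomes [0 rho; rho^T M + rho^T rho],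
    obtained by adding row [v] to the rows of the neighbors. Otherwise [M] and
    [1 rho; rho^T M + rho^T rho] are exchanged; [M] is the Schur complement of
    the corner entry in the latter. Both moves preserve the nullity. *)

Set Implicit Arguments.
Unset Strict Implicit.
Unset Printing Implicit Defensive.

Import GRing.Theory.
Local Open Scope ring_scope.

(** [U] carries the left kernel of [A] into that of [B], and [W] undoes [U] there, so this map is
    injective. *)
Lemma leq_rank_ker (F : fieldType) (m n : nat) (A : 'M[F]_m) (B : 'M[F]_n)
    (U : 'M_(m, n)) (W : 'M_(n, m)) :
  kermx A *m U *m B = 0 -> kermx A *m U *m W = kermx A ->
  (\rank (kermx A) <= \rank (kermx B))%N.
Proof.
move=> UB UW; rewrite -{1}UW.
by apply: leq_trans (mxrankM_maxl _ _) _; apply/mxrankS/sub_kermxP.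
Qed.

(** * Nullity of padded principal submatrices *)

Section Padding.
Variables (F : fieldType) (n : nat).
Implicit Types (K : {set 'I_n}) (M : 'M[F]_n).

(* Replaces the rows and columns outside [K] by those of the identity, so that
   principal submatrices of various sizes become matrices of a single size. *)
Definition padmx K M : 'M[F]_n :=
  \matrix_(i, j) if (i \in K) && (j \in K) then M i j else (i == j)%:R.

Lemma padmx_ij K M i j :
  padmx K M i j = if (i \in K) && (j \in K) then M i j else (i == j)%:R.
Proof. by rewrite mxE. Qed.

Lemma row_padmx K M i : i \notin K -> row i (padmx K M) = delta_mx 0 i.
Proof.
by move=> /negPf iK; apply/matrixP=> k j; rewrite !mxE iK ord1 eqxx eq_sym.
Qed.

Lemma col_padmx K M j : j \notin K -> col j (padmx K M) = (delta_mx 0 j)^T.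
Proof.
by move=> /negPf jK; apply/matrixP=> i k; rewrite !mxE jK andbF ord1 eqxx.
Qed.

Definition inclmx K : 'M[F]_(#|K|, n) := rowsub enum_val 1%:M.

Definition projmx K : 'M[F]_n := diag_mx (\row_i (i \in K)%:R).

Lemma inclmx_tr K : inclmx K *m (inclmx K)^T = 1%:M.
Proof.
apply/matrixP=> i j; rewrite mul_rowsub_mx mul1mx !mxE.
by rewrite (inj_eq enum_val_inj) eq_sym.
Qed.

Lemma tr_inclmx K : (inclmx K)^T *m inclmx K = projmx K.
Proof.
apply/matrixP=> i j; rewrite !mxE.
under eq_bigr => k _ do rewrite !mxE.
rewrite -(big_enum_val (fun k => (k == i)%:R * (k == j)%:R)) /=.
have [Ki|Ki] := boolP (i \in K).
  rewrite (bigD1 i) //= eqxx mul1r big1 ?addr0 // => k /andP[_ /negPf->].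
  by rewrite mul0r.
rewrite mul0rn big1 // => k Kk; case: eqP Kk Ki => [-> -> //|]; by rewrite mul0r.
Qed.

Lemma padmxE K M :
  padmx K M = projmx K *m M *m projmx K + (1%:M - projmx K).
Proof.
apply/matrixP=> i j; rewrite mul_mx_diag mul_diag_mx !mxE.
have [->|_] := eqVneq i j; case: (_ \in K); rewrite ?mulr1n ?mulr0n /=;
  try case: (_ \in K);
  by rewrite ?mul1r ?mulr1 ?mul0r ?mulr0 ?subrr ?subr0 ?addr0 ?add0r.
Qed.

Lemma mxsub_inclmx K M :
  mxsub enum_val enum_val M = inclmx K *m M *m (inclmx K)^T.
Proof.
by rewrite trmx_mxsub trmx1 mulmx_colsub mulmx1 mul_rowsub_mx mul1mx mxsubcr.
Qed.

(** The relations [E *m N = A *m E] and [N *m E^T = E^T *m A] make [E] and [E^T] carry the two left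
    kernels into each other. They are mutually inverse there because [NP] forces left kernel vectors
    of [N] to vanish outside [K]. *)
Lemma rank_ker_padmx K M :
  \rank (kermx (mxsub enum_val enum_val M : 'M_#|K|)) =
  \rank (kermx (padmx K M)).
Proof.
rewrite mxsub_inclmx padmxE; set E := inclmx K; set P := projmx K.
have EEt : E *m E^T = 1%:M := inclmx_tr K.
have EtE : E^T *m E = P := tr_inclmx K.
have EP : E *m P = E by rewrite -EtE mulmxA EEt mul1mx.
have PE : P *m E^T = E^T by rewrite -EtE -mulmxA EEt mulmx1.
have PP : P *m P = P by rewrite -{1}EtE -mulmxA EP EtE.
set A := E *m M *m _; set N := _ + _.
have EN : E *m N = A *m E.
  rewrite /A /N mulmxDr mulmxBr mulmx1 !mulmxA EP subrr addr0.
  by rewrite -(mulmxA _ E^T) EtE.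
have NE : N *m E^T = E^T *m A.
  by rewrite /A /N mulmxDl mulmxBl mul1mx -!mulmxA PE subrr addr0 !mulmxA EtE.
have NP : N *m (1%:M - P) = 1%:M - P.
  rewrite /N mulmxDl !mulmxBr !mulmxBl !mulmx1 !mul1mx -!mulmxA PP !subrr.
  by rewrite add0r subr0.
apply/eqP; rewrite eqn_leq; apply/andP; split.
  apply: (@leq_rank_ker _ _ _ _ _ E E^T); last by rewrite -mulmxA EEt mulmx1.
  by rewrite -mulmxA EN mulmxA mulmx_ker mul0mx.
have kerP : kermx N *m P = kermx N.
  apply/esym/eqP; rewrite -subr_eq0 -{1}[kermx N]mulmx1 -mulmxBr -NP mulmxA.
  by rewrite mulmx_ker mul0mx.
apply: (@leq_rank_ker _ _ _ _ _ E^T E); last by rewrite -mulmxA EtE.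
by rewrite -mulmxA -NE mulmxA mulmx_ker mul0mx.
Qed.

End Padding.

Lemma rank_ker_congr (F : fieldType) (n : nat) (A B : 'M[F]_n) :
  \rank A = \rank B -> \rank (kermx A) = \rank (kermx B).
Proof. by rewrite !mxrank_ker => ->. Qed.

(** * Rank-preserving moves at a pivot row *)

Section Pivot.
Variables (F : fieldType) (n : nat) (s : 'I_n) (rho : 'rV[F]_n).
Hypothesis rho_s : rho 0 s = 0.
Let e : 'rV[F]_n := delta_mx 0 s.

(** By [rho_s] the matrix [rho^T *m e] squares to zero, so changing its sign gives the inverse. *)
Lemma transvection_unit : 1%:M + rho^T *m e \in unitmx.
Proof.
have e0 : e *m rho^T = 0.
  by apply/matrixP=> i j; rewrite -rowE !mxE !ord1 rho_s.
suff /mulmx1_unit[] : (1%:M + rho^T *m e) *m (1%:M - rho^T *m e) = 1%:M by [].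
rewrite mulmxDl mul1mx mulmxBr mulmx1 -!mulmxA (mulmxA e) e0 mul0mx mulmx0.
by rewrite subr0 subrK.
Qed.

Lemma rank_add_row (N : 'M_n) :
  row s N = rho -> \rank (N + rho^T *m rho)%R = \rank N.
Proof.
move=> Ns; have -> : N + rho^T *m rho = (1%:M + rho^T *m e) *m N.
  by rewrite mulmxDl mul1mx -mulmxA -rowE Ns.
by rewrite eqmxMfull ?row_full_unit ?transvection_unit.
Qed.

(** The left side is the congruence [L *m N *m L^T] by a transvection: it spreads the isolated pivot
    1 of [N] along [rho]. *)
Lemma rank_schur (N : 'M_n) :
  row s N = e -> col s N = e^T ->
  \rank (N + rho^T *m rho + (e^T *m rho + rho^T *m e))%R = \rank N.
Proof.
move=> rN cN; set L := 1%:M + rho^T *m e.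
have -> : N + rho^T *m rho + (e^T *m rho + rho^T *m e) = L *m N *m L^T.
  have LN : L *m N = N + rho^T *m e.
    by rewrite mulmxDl mul1mx -mulmxA -rowE rN.
  have NeT : N *m e^T = e^T by rewrite /e trmx_delta -colE cN /e trmx_delta.
  have eeT : e *m e^T = 1%:M.
    by apply/matrixP=> i j; rewrite -rowE !mxE !ord1 !eqxx.
  have LT : L^T = 1%:M + e^T *m rho by rewrite linearD /= trmx1 trmx_mul trmxK.
  rewrite LN LT mulmxDl !mulmxDr !mulmx1 !mulmxA NeT -(mulmxA _ e) eeT mulmx1.
  by rewrite -!addrA; congr (_ + _); rewrite addrC -addrA.
rewrite mxrankMfree ?row_free_unit ?unitmx_tr ?transvection_unit //.
by rewrite eqmxMfull ?row_full_unit ?transvection_unit.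
Qed.

End Pivot.

Lemma natr_addb2 (a b : bool) : (a (+) b)%:R = a%:R + b%:R :> 'F_2.
Proof. by case: a b => [] []; apply/eqP. Qed.

Lemma natr_eq1_2 (a : bool) : (a%:R == 1 :> 'F_2) = a.
Proof. by case: a. Qed.

Lemma natr_eq0_2 (a : bool) : (a%:R == 0 :> 'F_2) = ~~ a.
Proof. by case: a. Qed.

(** * Effect of marked local complementation on the padded matrices *)

Section LocalComplement.
Variables (V : finType) (G : mgraph V) (v : V) (T : {set V}).
Let G' := marked_lc G v.

Definition diag_entry (H : mgraph V) (x : V) : bool :=
  looped H x (+) (x \in T) (+) involves_r (marking H x).

Lemma bracket_mxE (H : mgraph V) i j :
  (adjm H + deltam H T) i j =
  (if i == j then diag_entry H (enum_val i)
   else adjacent H (enum_val i) (enum_val j))%:R.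
Proof.
rewrite !mxE /diag_entry; case: (i == j); last by rewrite mulr0n addr0.
by rewrite mulr1n -natr_addb2 addbA.
Qed.

Lemma in_kept (H : mgraph V) i :
  (i \in kept H T) =
  ~~ (if diag_entry H (enum_val i) then u_or_ur (marking H (enum_val i))
      else c_or_cr (marking H (enum_val i))).
Proof.
rewrite inE /removed bracket_mxE eqxx natr_eq1_2 natr_eq0_2.
by case: (diag_entry _ _); rewrite ?andbT ?andbF ?orbF.
Qed.

Lemma adjacentxx (H : mgraph V) x : adjacent H x x = false.
Proof. by rewrite /adjacent eqxx. Qed.

Lemma adjacent_sym (H : mgraph V) x y : adjacent H x y = adjacent H y x.
Proof. by rewrite /adjacent eq_sym edge_sym. Qed.

Lemma looped_lc x : looped G' x = looped G x.
Proof. by rewrite /looped /= /lc_edge eqxx addbF. Qed.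

Lemma adjacent_lc x y : x != y ->
  adjacent G' x y = adjacent G x y (+) (adjacent G v x && adjacent G v y).
Proof. by rewrite {1 2}/adjacent /= /lc_edge => ->. Qed.

(** [mark_neighbor] always toggles the letter r, and loops do not change. *)
Lemma diag_entry_lc x : x != v ->
  diag_entry G' x = diag_entry G x (+) adjacent G v x.
Proof.
rewrite /diag_entry looped_lc /= /lc_marking => /negPf->.
by case: (adjacent G v x); case: (marking G x); rewrite ?addbT ?addbF ?negbK.
Qed.

Let s := enum_rank v.
Let adjv (i : 'I_#|V|) : bool := adjacent G v (enum_val i).
Let D := adjm G + deltam G T.
Let D' := adjm G' + deltam G' T.
Let K := kept G T.
Let K' := kept G' T.
(** Restricting to [K] keeps the update [rho^T *m rho] away from the padding. As [K] and [K'] agree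
    off [s], one [rho] serves both matrices. *)
Let rho : 'rV['F_2]_#|V| := \row_i (adjv i && (i \in K))%:R.

Lemma enum_val_neq (i : 'I_#|V|) : i != s -> enum_val i != v.
Proof. by apply: contraNneq => iv; rewrite /s -iv enum_valK. Qed.

Lemma adjv_s : adjv s = false.
Proof. by rewrite /adjv enum_rankK adjacentxx. Qed.

(** Toggled adjacencies and flipped diagonal entries of neighbors form a single rank-one update.
    Only the corner at [s] escapes it, being governed by [mark_center]. *)
Lemma bracket_mx_lc i j : (i != s) || (j != s) ->
  D' i j = D i j + (adjv i && adjv j)%:R.
Proof.
rewrite !bracket_mxE -natr_addb2 => sN; congr (_ %:R).
have [ij|ij] := eqVneq i j.
  by move: sN; rewrite -ij orbb => /enum_val_neq/diag_entry_lc->; rewrite andbb.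
by rewrite adjacent_lc // (inj_eq enum_val_inj).
Qed.

(** At a neighbor the diagonal entry flips while [mark_neighbor] exchanges marks removed at 0 (c,
    cr) with marks removed at 1 (u, ur). *)
Lemma kept_lc i : i != s -> (i \in K') = (i \in K).
Proof.
move=> /enum_val_neq iv; rewrite !in_kept diag_entry_lc //.
rewrite [marking G' _]/= /lc_marking (negPf iv).
by case: (adjacent G v _); case: (diag_entry G _); case: (marking G _).
Qed.

(** Between c and cr the entry flips, so exactly one of the two is kept, with entry 1. For the other
    marks the entry stays: 0 is kept on both sides, and 1 is removed on exactly the side marked u or
    ur. *)
Lemma center_lc :
  if (s \in K) && (s \in K') then D s s = 0 /\ D' s s = 0
  else (s \in K -> D s s = 1) /\ (s \in K' -> D' s s = 1) /\
    (s \in K) != (s \in K').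
Proof.
rewrite !in_kept !bracket_mxE !eqxx !enum_rankK /diag_entry looped_lc.
rewrite [marking G' _]/= /lc_marking eqxx.
case: (_ (+) (v \in T)); case: (marking G v) => //=.
Qed.

Lemma rhoE j : rho 0 j = (adjv j && (j \in K))%:R.
Proof. by rewrite mxE. Qed.

Lemma padmx_center j : j != s ->
  padmx K D s j = (s \in K)%:R * rho 0 j /\
  padmx K' D' s j = (s \in K')%:R * rho 0 j.
Proof.
move=> js; rewrite !padmx_ij rhoE (kept_lc js) (@bracket_mx_lc s j) ?js ?orbT // adjv_s addr0.
rewrite [D s j]bracket_mxE eq_sym (negPf js) enum_rankK -/(adjv j).
by case: (j \in K); rewrite ?andbT ?andbF ?mulr0 //;
  case: (_ \in K); case: (_ \in K'); rewrite ?mul1r ?mul0r.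
Qed.

Lemma padmx_off_center i j : i != s -> j != s ->
  padmx K' D' i j = padmx K D i j + rho 0 i * rho 0 j.
Proof.
move=> is_ js; rewrite !padmx_ij !rhoE (kept_lc is_) (kept_lc js) bracket_mx_lc ?is_ //.
case: (i \in K); case: (j \in K);
  rewrite ?andbT ?andbF ?mulr0 ?mul0r ?addr0 //.
by rewrite -natrM mulnb.
Qed.

Lemma bracket_mx_sym (H : mgraph V) i j :
  (adjm H + deltam H T) i j = (adjm H + deltam H T) j i.
Proof. by rewrite !bracket_mxE eq_sym adjacent_sym; case: eqP => // ->. Qed.

Lemma padmx_sym (L : {set 'I_#|V|}) (M : 'M['F_2]_#|V|) i j :
  (forall i j, M i j = M j i) -> padmx L M i j = padmx L M j i.
Proof. by move=> Msym; rewrite !padmx_ij andbC eq_sym Msym. Qed.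

Lemma rank_padmx_lc : \rank (padmx K D) = \rank (padmx K' D').
Proof.
have rho_s : rho 0 s = 0 by rewrite rhoE adjv_s.
have symD i j : padmx K D i j = padmx K D j i.
  by apply: padmx_sym; apply: bracket_mx_sym.
have symD' i j : padmx K' D' i j = padmx K' D' j i.
  by apply: padmx_sym; apply: bracket_mx_sym.
have rhoM i j : (rho^T *m rho) i j = rho 0 i * rho 0 j.
  by rewrite mxE big_ord1 mxE.
have := center_lc; case: ifP => [/andP[sK sK'] [D0 D0']|_ [D1 [D1' sKK']]].
  have sN : padmx K D s s = 0 by rewrite padmx_ij sK.
  have sN' : padmx K' D' s s = 0 by rewrite padmx_ij sK'.
  have rowN : row s (padmx K D) = rho.
    apply/matrixP=> k j; rewrite ord1 mxE.
    have [->|js] := eqVneq j s; first by rewrite sN rho_s.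
    by rewrite (padmx_center js).1 sK mul1r.
  rewrite -(rank_add_row rho_s rowN); congr (\rank _).
  apply/matrixP=> i j; rewrite mxE rhoM.
  (* By symmetry of both matrices only the corner and the rows other than [s] need checking. *)
  wlog is_ : i j / i != s.
    move=> IH; have [i_s|/IH//] := eqVneq i s.
    have [j_s|/IH] := eqVneq j s; last by rewrite symD symD' mulrC.
    by rewrite i_s j_s sN sN' rho_s mulr0 addr0.
  have [->|js] := eqVneq j s; last by rewrite padmx_off_center.
  rewrite rho_s mulr0 addr0 symD symD' (padmx_center is_).1.
  by rewrite (padmx_center is_).2 sK sK'.
pose e : 'rV['F_2]_#|V| := delta_mx 0 s.
pose Z := rho^T *m rho + (e^T *m rho + rho^T *m e).
have ZE i j :
    Z i j = rho 0 i * rho 0 j + ((i == s)%:R * rho 0 j + rho 0 i * (j == s)%:R).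
  by rewrite !mxE !big_ord1 !mxE !eqxx.
have symZ i j : Z i j = Z j i.
  by rewrite !ZE mulrC [_ * rho 0 j]mulrC [rho 0 i * _]mulrC
    [_ + _ * rho 0 i]addrC.
(* The corner is 1 in either case: a genuine entry if [s] is kept, identity padding if it is
   removed. *)
have sN : padmx K D s s = 1.
  by rewrite padmx_ij eqxx; case: ifP => // /andP[/D1].
have sN' : padmx K' D' s s = 1.
  by rewrite padmx_ij eqxx; case: ifP => // /andP[/D1'].
have addZ : padmx K' D' = padmx K D + Z.
  apply/matrixP=> i j; rewrite [RHS]mxE.
  wlog is_ : i j / i != s.
    move=> IH; have [i_s|/IH//] := eqVneq i s.
    have [j_s|/IH] := eqVneq j s; last by rewrite symD symD' symZ.
    by rewrite i_s j_s sN sN' ZE rho_s !mulr0 mul0r !addr0.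
  have [->|js] := eqVneq j s; last first.
    rewrite padmx_off_center // ZE (negPf is_) (negPf js).
    by rewrite mul0r mulr0 !addr0.
  rewrite ZE rho_s !mulr0 !add0r eqxx mulr1 symD symD'.
  rewrite (padmx_center is_).1 (padmx_center is_).2.
  (* Exactly one of [K] and [K'] contains [s], so their indicators at [s] differ by 1 in ['F_2]. *)
  rewrite -[X in _ + X]mul1r -mulrDl; congr (_ * _).
  by case: (s \in K) (s \in K') sKK' => [] [] // _; apply/eqP.
(* In characteristic 2 adding [Z] is an involution, so [rank_schur] can start from whichever padded
   matrix has [s] removed. *)
have ZZ : Z + Z = 0.
  by apply/matrixP=> i j; rewrite mxE (addrr_pchar2 (pchar_Fp _)) ?mxE.
have [sK|sK] := boolP (s \in K); last first.
  by rewrite addZ addrA (rank_schur rho_s) ?row_padmx ?col_padmx.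
have sK' : s \notin K' by move: sKK'; rewrite sK; case: (s \in K').
have -> : padmx K D = padmx K' D' + Z by rewrite addZ -addrA ZZ addr0.
by rewrite addrA (rank_schur rho_s) ?row_padmx ?col_padmx.
Qed.

Lemma nullity_adjm_T_lc : nullity (adjm_T G T) = nullity (adjm_T G' T).
Proof.
rewrite /nullity /adjm_T !rank_ker_padmx; apply: rank_ker_congr.
exact: rank_padmx_lc.
Qed.

End LocalComplement.

Theorem theorem20 (V : finType) (G : mgraph V) (v : V) :
  bracket G = bracket (marked_lc G v).
Proof.
rewrite /bracket; under eq_bigr => T _ do rewrite (nullity_adjm_T_lc G v T).
by [].
Qed.
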